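(* There exist unique choices of $X$, $W$, a subcategory $\mathcal{C}\subseteq\mathcal{T}$ and a congruence relation $\sim$ on $\mathcal{C}$ satisfying Axioms 1, 2 and 3 below. Moreover, these choices also satisfy Axiom 4, and under them both the rate-of-wedge-closure formula $|\mathsf{Hom}^X_{\mathcal{C}/\sim}(W,G)|/|\mathsf{Hom}_{\mathcal{C}/\sim}(W,G)|$ and the alcove-to-wedge ratio $|\mathsf{Hom}_{\mathcal{C}/\sim}(X,G)|/|\mathsf{Hom}_{\mathcal{C}/\sim}(W,G)|$ equal the exclusive clustering coefficient $C^\circ(G)$ for every affiliation network $G$. Axiom 1: $\mathcal{C}$ contains $\overline{\mathcal{T}}$. Axiom 2: whenever $\phi\sim\phi'$, also $\phi\simeq\phi'$ (images of each event under congruent morphisms are structurally equivalent). Axiom 3: for every AN $G$, every triad of $G$ and ordered triple $(i,j,k)$ of its distinct actors, there is at most one wedge at $(i,j,k)$. Axiom 4: for every AN $G$, if a triad of $G$ has wedges at two ordered triples with different centers, then both are closed.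
   Context: An affiliation network (AN) is a finite simple undirected bipartite graph whose nodes are actors and events, each edge joining an actor to an event. A graph map sends nodes to nodes and edges to edges; it is injective if injective on nodes and induced if its image is an induced subgraph of the target. For a set $S$ of actors of $G$, the subgraph scheduled by $S$ is induced by $S$ together with all events attended by at least two actors of $S$; a triad of $G$ is the subgraph scheduled by three actors. Two nodes of a graph are structurally equivalent if exchanging them and fixing all other nodes is an automorphism. $\mathcal{T}$: objects are triads (ANs with three actors, every event attended by at least two), morphisms $H\to K$ are graph maps sending actors of $H$ to distinct actors of $K$ and events to events. $\overline{\mathcal{T}}\subseteq\mathcal{T}$ is the subcategory of injective induced morphisms. Congruence relations (families of equivalence relations on hom-sets compatible with composition): $\phi\simeq\phi'$ iff they agree on actors and send each event to structurally equivalent events of the target; $\phi\approx\phi'$ iff they agree on actors. The paper fixes as standing choices $W$ = path $v_0v_1v_2v_3v_4$ (actors $v_0,v_2,v_4$; events $v_1,v_3$), $X$ = 6-cycle $v_0v_1\cdots v_5v_0$ (actors $v_0,v_2,v_4$; events $v_1,v_3,v_5$), $\iota:W\to X$, $\iota(v_i)=v_i$. For an AN $G$, $\mathsf{Hom}_{\mathcal{C}/\sim}(H,G)$ is the set of $\sim$-classes of morphisms in $\mathcal{C}$ from $H$ into triads of $G$; $\mathsf{Hom}^X_{\mathcal{C}/\sim}(W,G)$ consists of classes of $\phi$ with $\phi\sim\psi\circ\iota$ for some $\psi$ in $\mathcal{C}$ from $X$ into a triad of $G$. Wedges: elements of $\mathsf{Hom}_{\mathcal{C}/\sim}(W,G)$,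 closed if in $\mathsf{Hom}^X_{\mathcal{C}/\sim}(W,G)$, else open; alcoves: elements of $\mathsf{Hom}_{\mathcal{C}/\sim}(X,G)$. A wedge/alcove is at ordered triple $(i,j,k)$ if it sends $v_0,v_2,v_4$ to $i,j,k$; $j$ is its center. Choices are regarded as the same when they yield the same wedges and alcoves. The exclusive clustering coefficient is $C^\circ(G)=|\mathsf{Hom}^X_{\overline{\mathcal{T}}/\simeq}(W,G)|/|\mathsf{Hom}_{\overline{\mathcal{T}}/\simeq}(W,G)|$.
   Formalization: W, X and ι are fixed as the standing choices. Axioms 1–3 do not bound alcoves, so uniqueness gives the same wedges and closed wedges; alcoves are the same if there is at most one at each ordered triple, otherwise they only subdivide those of the exclusive choice. *)

(* Defs.v *)
From HB Require Import structures.
From mathcomp Require Import all_boot all_order all_fingroup all_algebra.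
Set Implicit Arguments.
Unset Strict Implicit.
Unset Printing Implicit Defensive.

Record affnet := AffNet {
  actor : finType;
  event : finType;
  attends : actor -> event -> bool }.

Definition node (G : affnet) : finType := (actor G + event G)%type.

Definition adj (G : affnet) (x y : node G) : bool :=
  match x, y with
  | inl a, inr e | inr e, inl a => attends a e
  | _, _ => false
  end.

Definition struct_equiv (G : affnet) (x y : node G) : bool :=
  [forall u, forall v, adj (tperm x y u) (tperm x y v) == adj u v].

Definition is_triad (G : affnet) : bool :=
  (#|actor G| == 3) && [forall e : event G, 1 < #|[set a | attends a e]|].

Record triad := Triad { net :> affnet; netP : is_triad net }.

(* A node map that respects the bipartition, given by its two components. *)
Definition bimap (H K : affnet) : finType :=
  ({ffun actor H -> actor K} * {ffun event H -> event K})%type.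

Definition node_map (H K : affnet) (f : bimap H K) (x : node H) : node K :=
  match x with inl a => inl (f.1 a) | inr e => inr (f.2 e) end.

Definition is_mor (H K : affnet) (f : bimap H K) : bool :=
  injectiveb f.1 &&
  [forall x, forall y, adj x y ==> adj (node_map f x) (node_map f y)].

(* The morphisms of the category T of triads. *)
Definition mor (H K : triad) : finType := {f : bimap H K | is_mor f}.

Lemma mor_id_subproof (H : triad) :
  is_mor ([ffun a => a], [ffun e => e] : {ffun event H -> event H}).
Proof.
apply/andP; split; first by apply/injectiveP => a b /=; rewrite !ffunE.
by apply/forallP => -[a|e]; apply/forallP => -[b|d] //=; rewrite !ffunE implybb.
Qed.

Definition mor_id (H : triad) : mor H H :=
  exist _ ([ffun a => a], [ffun e => e]) (mor_id_subproof H).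

Definition comp_bimap (H K L : affnet) (g : bimap K L) (f : bimap H K) :
    bimap H L :=
  ([ffun a => g.1 (f.1 a)], [ffun e => g.2 (f.2 e)]).

Lemma mor_comp_subproof (H K L : triad) (g : mor K L) (f : mor H K) :
  is_mor (comp_bimap (val g) (val f)).
Proof.
case: g f => [g /= /andP[/injectiveP gI /forallP gP]].
case=> [f /= /andP[/injectiveP fI /forallP fP]].
apply/andP; split; first by apply/injectiveP=> a b /=; rewrite !ffunE => /gI/fI.
apply/forallP=> x; apply/forallP=> y; apply/implyP=> xy.
have /implyP/(_ xy) fxy := forallP (fP x) y.
have /implyP/(_ fxy) := forallP (gP (node_map f x)) (node_map f y).
by case: x y {xy fxy} => [a|e] [b|d] //=; rewrite !ffunE.
Qed.

Definition mor_comp (H K L : triad) (g : mor K L) (f : mor H K) : mor H L :=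
  exist _ (comp_bimap (val g) (val f)) (mor_comp_subproof g f).

Definition mor_injective (H K : triad) (f : mor H K) : bool :=
  injectiveb (node_map (val f)).

(* Every edge of K between two nodes of the image is an edge of the image. *)
Definition mor_induced (H K : triad) (f : mor H K) : bool :=
  [forall x, forall y, adj (node_map (val f) x) (node_map (val f) y) ==>
    [exists x', exists y', [&& node_map (val f) x' == node_map (val f) x,
                               node_map (val f) y' == node_map (val f) y
                             & adj x' y']]].

Definition mor_family : Type := forall H K : triad, {set mor H K}.
Definition rel_family : Type := forall H K : triad, rel (mor H K).

(* Arrows-only presentation: the objects of C are the triads whose identity
   belongs to C. *)
Definition is_subcategory (C : mor_family) : Prop :=
  (forall (H K : triad) (f : mor H K), f \in C H K ->
     mor_id H \in C H H /\ mor_id K \in C K K) /\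
  (forall (H K L : triad) (f : mor H K) (g : mor K L),
     f \in C H K -> g \in C K L -> mor_comp g f \in C H L).

(* Only the values of R on morphisms of C are relevant. *)
Definition is_congruence (C : mor_family) (R : rel_family) : Prop :=
  (forall H K : triad, {in C H K & &, equivalence_rel (R H K)}) /\
  (forall (H K L : triad) (f f' : mor H K) (g g' : mor K L),
     f \in C H K -> f' \in C H K -> g \in C K L -> g' \in C K L ->
     R H K f f' -> R K L g g' -> R H L (mor_comp g f) (mor_comp g' f')).

Definition Tbar : mor_family :=
  fun H K => [set f | mor_injective f && mor_induced f].

Definition simeq : rel_family := fun H K f f' =>
  [forall a : actor H, (val f).1 a == (val f').1 a] &&
  [forall e : event H,
     struct_equiv (inr ((val f).2 e)) (inr ((val f').2 e) : node K)].

Definition scheduled (G : affnet) (S : {set actor G}) : affnet :=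
  @AffNet {a : actor G | a \in S}
          {e : event G | 1 < #|[set a in S | attends a e]|}
          (fun a e => attends (val a) (val e)).

Definition actor_triple (G : affnet) : finType :=
  {S : {set actor G} | #|S| == 3}.

Lemma scheduledP (G : affnet) (S : actor_triple G) : is_triad (scheduled (val S)).
Proof.
case: S => S /= /eqP S3; apply/andP; split; first by rewrite /= card_sig S3.
apply/forallP=> -[e /= eP]; apply: leq_trans eP _.
rewrite -(card_imset (mem [set a : {a | a \in S} | attends (val a) e]) val_inj).
apply/subset_leq_card/subsetP=> a; rewrite inE => /andP[aS ae].
by apply/imsetP; exists (exist _ a aS) => //; rewrite inE.
Qed.

Definition triad_of (G : affnet) (S : actor_triple G) : triad :=
  Triad (scheduledP S).

(* In W and X, actor i is v_(2i) and event i is v_(2i+1). *)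
Definition W_net : affnet :=
  @AffNet 'I_3 'I_2 (fun i e => (i == e :> nat) || (i == e.+1 :> nat)).

Definition X_net : affnet :=
  @AffNet 'I_3 'I_3 (fun i e => (i == e :> nat) || (i == e.+1 %% 3 :> nat)).

Lemma W_triadP : is_triad W_net.
Proof.
apply/andP; split; first by rewrite /= card_ord.
apply/forallP=> e; rewrite -sum1_card big_mkcond /= !big_ord_recl big_ord0 !inE.
by case: e => -[|[|?]] //= ?; rewrite /bump.
Qed.

Lemma X_triadP : is_triad X_net.
Proof.
apply/andP; split; first by rewrite /= card_ord.
apply/forallP=> e; rewrite -sum1_card big_mkcond /= !big_ord_recl big_ord0 !inE.
by case: e => -[|[|[|?]]] //= ?; rewrite /bump.
Qed.

Definition W : triad := Triad W_triadP.
Definition X : triad := Triad X_triadP.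

Definition v0 : 'I_3 := inord 0.
Definition v2 : 'I_3 := inord 1.
Definition v4 : 'I_3 := inord 2.

Definition iotaWX_map : bimap W X :=
  ([ffun i : 'I_3 => i], [ffun e : 'I_2 => widen_ord (leqnSn 2) e]).

Lemma iotaWX_subproof : is_mor iotaWX_map.
Proof.
apply/andP; split; first by apply/injectiveP=> a b /=; rewrite !ffunE.
have mod3 (e : 'I_2) : e.+1 %% 3 = e.+1 by rewrite modn_small // ltnS ltn_ord.
by apply/forallP=> -[a|e]; apply/forallP=> -[b|d] //=;
  rewrite !ffunE /= mod3 implybb.
Qed.

Definition iotaWX : mor W X := exist _ iotaWX_map iotaWX_subproof.

Definition classes_in (C : mor_family) (R : rel_family) (H K : triad) :
    {set {set mor H K}} :=
  equivalence_partition (R H K) (C H K).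

(* As w is a class, it contains psi \o iotaWX if and only if its elements are
   congruent to psi \o iotaWX. *)
Definition closed_in (C : mor_family) (K : triad) (w : {set mor W K}) : bool :=
  [exists psi in C X K, mor_comp psi iotaWX \in w].

(* The classes of morphisms from H into the triads of G, each one tagged with
   its triad. *)
Definition HomC (C : mor_family) (R : rel_family) (H : triad) (G : affnet) :
    {set {S : actor_triple G & {set mor H (triad_of S)}}} :=
  [set w | tagged w \in classes_in C R H (triad_of (tag w))].

Definition HomCX (C : mor_family) (R : rel_family) (G : affnet) :
    {set {S : actor_triple G & {set mor W (triad_of S)}}} :=
  [set w in HomC C R W G | closed_in C (tagged w)].

Definition wedge_at (K : triad) (w : {set mor W K}) (i j k : actor K) : bool :=
  [exists f in w, [&& (val f).1 v0 == i, (val f).1 v2 == j & (val f).1 v4 == k]].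

Definition alcove_at (K : triad) (a : {set mor X K}) (i j k : actor K) : bool :=
  [exists f in a, [&& (val f).1 v0 == i, (val f).1 v2 == j & (val f).1 v4 == k]].

Definition axiom1 (C : mor_family) : Prop :=
  forall H K : triad, Tbar H K \subset C H K.

Definition axiom2 (C : mor_family) (R : rel_family) : Prop :=
  forall (H K : triad) (f f' : mor H K), f \in C H K -> f' \in C H K ->
    R H K f f' -> simeq f f'.

Definition axiom3 (C : mor_family) (R : rel_family) : Prop :=
  forall (G : affnet) (S : actor_triple G) (i j k : actor (triad_of S)),
    uniq [:: i; j; k] ->
    {in classes_in C R W (triad_of S) &, forall w w',
       wedge_at w i j k -> wedge_at w' i j k -> w = w'}.

Definition axiom4 (C : mor_family) (R : rel_family) : Prop :=
  forall (G : affnet) (S : actor_triple G) (i j k i' j' k' : actor (triad_of S)),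
    j != j' ->
    {in classes_in C R W (triad_of S) &, forall w w',
       wedge_at w i j k -> wedge_at w' i' j' k' ->
       closed_in C w /\ closed_in C w'}.

(* The analogue of axiom3 for alcoves; it is not a consequence of the axioms. *)
Definition one_alcove (C : mor_family) (R : rel_family) : Prop :=
  forall (G : affnet) (S : actor_triple G) (i j k : actor (triad_of S)),
    uniq [:: i; j; k] ->
    {in classes_in C R X (triad_of S) &, forall a a',
       alcove_at a i j k -> alcove_at a' i j k -> a = a'}.

Definition admissible (C : mor_family) (R : rel_family) : Prop :=
  [/\ is_subcategory C, is_congruence C R, axiom1 C, axiom2 C R & axiom3 C R].

(* Equality of the alcoves of the two choices needs one_alcove: replacing
   simeq by equality on the hom-sets out of all triads that do not embed in W
   keeps the axioms and the wedges, but splits alcoves.  Without it, the same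
   morphisms represent alcoves, and the alcoves of (C', R') subdivide those of
   (C, R). *)
Definition same_choice (C' : mor_family) (R' : rel_family)
    (C : mor_family) (R : rel_family) : Prop :=
  forall G : affnet,
    [/\ HomC C' R' W G = HomC C R W G,
        HomCX C' R' G = HomCX C R G,
        one_alcove C' R' -> HomC C' R' X G = HomC C R X G
      & forall S : actor_triple G, let T := triad_of S in
          C' X T = C X T /\
          {in C X T &, forall f f', R' X T f f' -> R X T f f'}].

Local Open Scope ring_scope.

(* As x / 0 = 0 in rat, all three quantities are 0 when G has no wedge. *)
Definition closure_rate (C : mor_family) (R : rel_family) (G : affnet) : rat :=
  #|HomCX C R G|%:R / #|HomC C R W G|%:R.

Definition alcove_wedge_ratio (C : mor_family) (R : rel_family) (G : affnet) :
    rat :=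
  #|HomC C R X G|%:R / #|HomC C R W G|%:R.

Definition exclusive_cc (G : affnet) : rat :=
  #|HomCX Tbar simeq G|%:R / #|HomC Tbar simeq W G|%:R.

(* Main.v *)
Require Import Defs.
From mathcomp Require Import all_boot all_order all_fingroup all_algebra.
Set Implicit Arguments.
Unset Strict Implicit.
Unset Printing Implicit Defensive.

(* The choice is Tbar with simeq.  A map of triads is bijective on actors, and a
   morphism of Tbar also reflects attendance, so simeq on Tbar is equality on
   actors; this gives Axioms 1-3 and the bijection psi |-> psi \o iota between
   alcoves and closed wedges.
   Uniqueness: let f : W -> K belong to an admissible C.  Glue to K a fresh copy
   of each event of W along f.  In this larger triad, f and the copy of W are two
   wedges at the same triple, so by Axioms 3 and 2 the events of f are attended
   as those of the copy, which puts f in Tbar.  For X, precompose with the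
   embeddings W -> X, whose images cover X.
   Axiom 4: the events of two wedges with different centers have all three pairs
   of actors as their sets of attendees. *)

(** * Structural equivalence and the morphisms of [Tbar] in terms of attendance *)

Lemma struct_equivP (K : affnet) (e d : event K) :
  reflect (forall a, attends a e = attends a d)
          (struct_equiv (inr e : node K) (inr d : node K)).
Proof.
apply: (iffP idP) => [/forallP eqv a | eqv].
  have /eqP := forallP (eqv (inl a)) (inr e).
  by rewrite tpermL tpermD.
have swap c f : attends c (if f == e then d else if f == d then e else f)
                = attends c f.
  by case: (eqVneq f e) => [->|_]; [|case: eqVneq => [->|_]].
(* Swapping two events fixes every actor, so adjacency after the swap reduces to [swap]. *)
have nodeE u : tperm (inr e) (inr d) u = match u with
    | inl c => inl c
    | inr f => inr (if f == e then d else if f == d then e else f) end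
    :> node K.
  case: u => [c|f]; first by rewrite tpermD.
  case: tpermP => [[->]|[->]|ne nd]; rewrite ?eqxx //.
    by case: eqVneq => [->|].
  by do 2?[case: eqVneq => [E|_]; first by rewrite E in ne nd].
apply/forallP => -[a|f]; apply/forallP => -[b|g];
  by rewrite !nodeE //= swap.
Qed.

Lemma is_morP (H K : affnet) (f : bimap H K) :
  reflect (injective f.1 /\ forall a e, attends a e -> attends (f.1 a) (f.2 e))
          (is_mor f).
Proof.
apply: (iffP andP) => [[/injectiveP fI /forallP fP] | [fI fP]]; split=> //.
- by move=> a e; apply/implyP: (forallP (fP (inl a)) (inr e)).
- exact/injectiveP.
apply/forallP => -[a|e]; apply/forallP => -[b|d]; apply/implyP => //=; exact: fP.
Qed.

Lemma mor_actor_bij (H K : triad) (f : mor H K) : bijective (val f).1.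
Proof.
have /is_morP[fI _] := valP f; apply: inj_card_bij => //.
by have /andP[/eqP-> _] := netP H; have /andP[/eqP-> _] := netP K.
Qed.

Lemma mor_actor_inj (H K : triad) (f : mor H K) : injective (val f).1.
Proof. exact/bij_inj/mor_actor_bij. Qed.

Definition exact_map (H K : affnet) (f : bimap H K) : Prop :=
  forall a e, attends (f.1 a) (f.2 e) = attends a e.

Lemma TbarP (H K : triad) (f : mor H K) :
  reflect (injective (val f).2 /\ exact_map (val f)) (f \in Tbar H K).
Proof.
rewrite inE; apply: (iffP andP) => [[/injectiveP fI /forallP fP] | [fI fE]].
  split=> [e d efd | a e]; first by apply: (@inr_inj (actor H)); apply: fI; rewrite /= efd.
  apply/idP/idP => [fae|]; last by have /is_morP[_] := valP f; apply.
  have /implyP/(_ fae)/existsP[x /existsP[y]] :=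
    forallP (fP (inl a)) (inr e).
  by case/and3P=> /eqP/fI-> /eqP/fI->.
split.
  apply/injectiveP => -[a|e] [b|d] //= [].
    by move/(@mor_actor_inj _ _ f)->.
  by move/fI->.
apply/forallP => x; apply/forallP => y; apply/implyP => fxy.
apply/existsP; exists x; apply/existsP; exists y; rewrite !eqxx /=.
by case: x y fxy => [a|e] [b|d] //=; rewrite fE.
Qed.

Definition separated (H : affnet) : Prop :=
  forall e d : event H, (forall a, attends a e = attends a d) -> e = d.

(** Events with a common image have the same attendees by exactness, so on a separated source
    injectivity on events comes for free. Both [W] and [X] are separated. *)
Lemma exact_Tbar (H K : triad) (f : mor H K) :
  separated H -> exact_map (val f) -> f \in Tbar H K.
Proof.
move=> sepH fE; apply/TbarP; split=> // e d efd.
by apply: sepH => a; rewrite -!fE efd.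
Qed.

Lemma Tbar_mor (H K : triad) (f : bimap H K) :
  injective f.1 -> injective f.2 -> exact_map f ->
  exists2 g : mor H K, val g = f & g \in Tbar H K.
Proof.
move=> fI1 fI2 fE; have fP : is_mor f by apply/is_morP; split=> // a e ae; rewrite fE.
by exists (exist _ f fP) => //; apply/TbarP.
Qed.

Lemma Tbar_id (H : triad) : mor_id H \in Tbar H H.
Proof. by apply/TbarP; split=> [e d|a e] /=; rewrite !ffunE. Qed.

Lemma Tbar_comp (H K L : triad) (f : mor H K) (g : mor K L) :
  f \in Tbar H K -> g \in Tbar K L -> mor_comp g f \in Tbar H L.
Proof.
move=> /TbarP[fI fE] /TbarP[gI gE].
apply/TbarP; split=> [e d|a e] /=; rewrite !ffunE; first by move/gI/fI.
by rewrite gE fE.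
Qed.

Lemma Tbar_subcategory : is_subcategory Tbar.
Proof.
by split=> [H K f _|H K L f g]; [split; apply: Tbar_id | apply: Tbar_comp].
Qed.

Lemma simeqP (H K : triad) (f f' : mor H K) :
  reflect ((val f).1 = (val f').1 /\
           forall e a, attends a ((val f).2 e) = attends a ((val f').2 e))
          (simeq f f').
Proof.
apply: (iffP andP) => [[/forallP eq1 /forallP eq2] | [eq1 eq2]]; split.
- by apply/ffunP => a; apply/eqP.
- by move=> e; apply/struct_equivP.
- by apply/forallP => a; rewrite eq1.
- by apply/forallP => e; apply/struct_equivP.
Qed.

(* Actor maps between triads are bijective, so exactness determines the set of
   attendees of the image of an event. *)
Lemma simeq_Tbar (H K : triad) :
  {in Tbar H K &, forall f f', simeq f f' = ((val f).1 == (val f').1)}.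
Proof.
move=> f f' /TbarP[_ fE] /TbarP[_ f'E].
apply/simeqP/eqP => [[]//|eq1]; split=> // e b.
have [g _ gK] := mor_actor_bij f; rewrite -[b]gK fE.
by rewrite eq1 f'E.
Qed.

Lemma simeq_congruence : is_congruence Tbar simeq.
Proof.
split=> [H K f g h fT gT hT|H K L f f' g g' fT f'T gT g'T].
  by rewrite !simeq_Tbar // eqxx; split=> // /eqP->.
rewrite !simeq_Tbar ?Tbar_comp // => /eqP eqf /eqP eqg.
by apply/eqP/ffunP => a; rewrite !ffunE eqf eqg.
Qed.

(** * Congruence classes and the bound of one class per triple *)

Lemma mem_classes (C : mor_family) (R : rel_family) (H K : triad)
    (w : {set mor H K}) (f : mor H K) :
  is_congruence C R -> w \in classes_in C R H K -> f \in w ->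
  f \in C H K /\ w = [set g in C H K | R H K f g].
Proof.
move=> [eqR _] /imsetP[g gC ->]; rewrite inE => /andP[fC Rgf]; split=> //.
apply/setP => h; rewrite !inE; case hC: (h \in _) => //=.
by have [_ /(_ Rgf)] := eqR H K g f h gC fC hC.
Qed.

Lemma class_in (C : mor_family) (R : rel_family) (H K : triad) (f : mor H K) :
  f \in C H K -> [set g in C H K | R H K f g] \in classes_in C R H K.
Proof. by move=> fC; apply/imsetP; exists f. Qed.

Lemma class_refl (C : mor_family) (R : rel_family) (H K : triad) (f : mor H K) :
  is_congruence C R -> f \in C H K -> f \in [set g in C H K | R H K f g].
Proof.
by move=> [eqR _] fC; rewrite inE fC; have [] := eqR H K f f f fC fC fC.
Qed.

Lemma eq_classes (C C' : mor_family) (R R' : rel_family) (H K : triad) :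
  C' H K = C H K -> {in C H K &, R' H K =2 R H K} ->
  classes_in C' R' H K = classes_in C R H K.
Proof.
move=> eqC eqR; rewrite /classes_in /equivalence_partition eqC.
apply: eq_in_imset => f fC; apply/setP => g; rewrite !inE.
by case gC: (g \in _); rewrite //= eqR.
Qed.

Lemma ord3P (i : 'I_3) : [\/ i = v0, i = v2 | i = v4].
Proof.
case: i => -[|[|[|?]]] // p; [apply: Or31|apply: Or32|apply: Or33];
  by apply/val_inj; rewrite /= inordK.
Qed.

(** The form of Axiom 3 and of [one_alcove] that mentions neither classes nor triples. *)
Definition actor_determined (C : mor_family) (R : rel_family) (H K : triad) :=
  {in C H K &, forall f f', (val f).1 = (val f').1 -> R H K f f'}.

Lemma simeq_determined (H K : triad) : actor_determined Tbar simeq H K.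
Proof. by move=> f f' fT f'T eq1; rewrite simeq_Tbar // eq1. Qed.

Section OneClass.

Variables (E : finType) (att : 'I_3 -> E -> bool).
Hypothesis HP : is_triad (AffNet att).
Let H : triad := Triad HP.
Variables (C : mor_family) (R : rel_family) (K : triad).

Let at_triple (w : {set mor H K}) (i j k : actor K) : bool :=
  [exists f in w, [&& (val f).1 v0 == i, (val f).1 v2 == j & (val f).1 v4 == k]].

Let one_class := forall i j k : actor K, uniq [:: i; j; k] ->
  {in classes_in C R H K &, forall w w',
     at_triple w i j k -> at_triple w' i j k -> w = w'}.

(** A morphism lies at the triple that lists its actor map, and this triple is duplicate-free
    because actor maps are injective. The source is any triad with actors ['I_3], so that [W] and
    [X] are treated at once. *)
Lemma one_classP : is_congruence C R -> one_class <-> actor_determined C R H K.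
Proof.
move=> CR; split=> [one f f' fC f'C eq1 | det i j k _ w w' wC w'C].
  have f'w' := class_refl CR f'C.
  suff: f' \in [set g in C H K | R f g] by rewrite inE => /andP[].
  have v02 : v0 != v2 by rewrite -val_eqE /= !inordK.
  have v04 : v0 != v4 by rewrite -val_eqE /= !inordK.
  have v24 : v2 != v4 by rewrite -val_eqE /= !inordK.
  have uniqf : uniq [:: (val f).1 v0; (val f).1 v2; (val f).1 v4].
    by rewrite /= !inE !(inj_eq (@mor_actor_inj _ _ f)) negb_or v02 v04 v24.
  rewrite (one ((val f).1 v0) ((val f).1 v2) ((val f).1 v4) uniqf _ _
             (class_in R fC) (class_in R f'C)) //.
  - by apply/existsP; exists f; rewrite class_refl //= !eqxx.
  - by apply/existsP; exists f'; rewrite f'w' eq1 !eqxx.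
case/exists_inP=> f fw /and3P[/eqP f0 /eqP f2 /eqP f4].
case/exists_inP=> g gw /and3P[/eqP g0 /eqP g2 /eqP g4].
have [fC ->] := mem_classes CR wC fw; have [gC w'E] := mem_classes CR w'C gw.
have /(det _ _ fC gC) Rfg : (val f).1 = (val g).1.
  by apply/ffunP => a; case: (ord3P a) => ->; rewrite ?f0 ?f2 ?f4.
have [|_ ->] := mem_classes CR (class_in R fC) (f := g); first by rewrite inE gC.
by rewrite -w'E.
Qed.

End OneClass.

Lemma axiom3P (C : mor_family) (R : rel_family) : is_congruence C R ->
  axiom3 C R <-> forall (G : affnet) (S : actor_triple G),
                   actor_determined C R W (triad_of S).
Proof.
by move=> CR; split=> ax G S; apply/(one_classP W_triadP _ CR)/ax.
Qed.

Lemma one_alcoveP (C : mor_family) (R : rel_family) : is_congruence C R ->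
  one_alcove C R <-> forall (G : affnet) (S : actor_triple G),
                       actor_determined C R X (triad_of S).
Proof.
by move=> CR; split=> ax G S; apply/(one_classP X_triadP _ CR)/ax.
Qed.

Lemma Tbar_admissible : admissible Tbar simeq.
Proof.
split=> //; [exact: Tbar_subcategory|exact: simeq_congruence|].
apply/axiom3P; first exact: simeq_congruence.
by move=> G S; apply: simeq_determined.
Qed.

(** * Gluing copies of events to a triad, and exactness of determined morphisms *)

Section Glue.

Variables (H K : triad) (f : mor H K).

(** The copy [inr d] is attended exactly by the images of the attendees of [d], whereas the event
    [(val f).2 d] of [K] may have further attendees. *)
Definition glue_net : affnet :=
  @AffNet (actor K) (event K + event H)%type (fun a e => match e with
    | inl e => attends a e
    | inr d => a \in (val f).1 @: [set b | attends b d]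
    end).

Lemma glue_triadP : is_triad glue_net.
Proof.
have /andP[K3 /forallP KP] := netP K; have /andP[_ /forallP HP] := netP H.
apply/andP; split=> //; apply/forallP => -[e|d]; first exact: KP.
rewrite /= (_ : [set _ | _] = (val f).1 @: [set b | attends b d]).
  by rewrite card_imset //; apply: mor_actor_inj.
by apply/setP => a; rewrite inE.
Qed.

Definition glue : triad := Triad glue_triadP.

Lemma glue_inl : exists2 g : mor K glue,
  val g = ([ffun a => a], [ffun e => inl e]) & g \in Tbar K glue.
Proof.
apply: Tbar_mor => [a b|e d|a e]; rewrite /= !ffunE //.
by case.
Qed.

Lemma glue_inr : exists2 g : mor H glue,
  val g = ([ffun a => (val f).1 a], [ffun e => inr e]) & g \in Tbar H glue.
Proof.
apply: Tbar_mor => [a b|e d|a e]; rewrite /= !ffunE; first exact: mor_actor_inj.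
  by case.
by rewrite mem_imset ?inE //; apply: mor_actor_inj.
Qed.

End Glue.

(** Axiom 3 speaks only of triads of the form [triad_of S]. Any triad embeds in such a one, the
    triad scheduled by all of its own actors. *)
Lemma triad_of_setT (K : triad) : exists S : actor_triple K,
  exists h : mor K (triad_of S), h \in Tbar K (triad_of S).
Proof.
have /andP[K3 /forallP KP] := netP K.
have S3 : #|[set: actor K]| == 3 by rewrite cardsT.
pose S : actor_triple K := exist _ setT S3; exists S.
have SP e : 1 < #|[set a in val S | attends a e]|.
  by rewrite (eq_card (B := [set a | attends a e])) ?KP // => a; rewrite !inE.
pose h : bimap K (triad_of S) := ([ffun a => exist _ a (in_setT a)],
  [ffun e => exist (fun e => is_true (1 < #|[set a in val S | attends a e]|))
                   e (SP e)]).
have [||| g _ gT] := @Tbar_mor K (triad_of S) h; last by exists g.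
- by move=> a b; rewrite /= !ffunE => -[].
- by move=> e d; rewrite /= !ffunE => -[].
by move=> a e; rewrite /= !ffunE.
Qed.

Lemma determined_exact (C : mor_family) (R : rel_family) (H K : triad)
    (f : mor H K) :
  is_subcategory C -> axiom1 C -> axiom2 C R ->
  (forall (G : affnet) (S : actor_triple G),
     actor_determined C R H (triad_of S)) ->
  f \in C H K -> exact_map (val f).
Proof.
move=> [_ Ccomp] ax1 ax2 det fC.
have [g gE gT] := glue_inl f; have [g' g'E g'T] := glue_inr f.
have [S [h hT]] := triad_of_setT (glue f).
have [_ hgE] := TbarP _ (Tbar_comp gT hT).
have [_ hg'E] := TbarP _ (Tbar_comp g'T hT).
have inC := fun K L => subsetP (ax1 K L).
(* [p] sends events through [K] and [q] sends them to the fresh copies, with the same effect on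
   actors. *)
pose p := mor_comp (mor_comp h g) f; pose q := mor_comp h g'.
have pC : p \in C H (triad_of S).
  exact: (Ccomp _ _ _ _ _ fC (Ccomp _ _ _ _ _ (inC _ _ _ gT) (inC _ _ _ hT))).
have qC : q \in C H (triad_of S) := Ccomp _ _ _ _ _ (inC _ _ _ g'T) (inC _ _ _ hT).
have pq1 : (val p).1 = (val q).1.
  by apply/ffunP => a; rewrite /= !ffunE gE g'E /= !ffunE.
have /simeqP[_ pq2] := ax2 _ _ _ _ pC qC (det _ _ _ _ pC qC pq1).
(* Exactness passes from [q] to [p], whose events have the same attendees, and then to [f] because
   [mor_comp h g] is exact. *)
move=> a e; rewrite -hg'E -[in RHS]pq2 -pq1.
by rewrite /= !ffunE -hgE /= !ffunE.
Qed.

(** * Embeddings of [W] in [X], and uniqueness of the choice *)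

Lemma W_separated : separated W.
Proof.
move=> [[|[|?]] // p] [[|[|?]] // q] eq_att; apply/val_inj => //=.
  by have := eq_att (@Ordinal 3 0 isT).
by have := eq_att (@Ordinal 3 0 isT).
Qed.

Lemma X_separated : separated X.
Proof.
(* Actors 0 and 1 suffice to tell the three events of the 6-cycle apart. *)
move=> [[|[|[|?]]] // p] [[|[|[|?]]] // q] eq_att; have := eq_att (@Ordinal 3 0 isT);
  have := eq_att (@Ordinal 3 1 isT); rewrite //= => _ _; exact/val_inj.
Qed.

Lemma iotaWX_Tbar : iotaWX \in Tbar W X.
Proof.
apply: exact_Tbar; first exact: W_separated.
move=> a e; rewrite /= !ffunE /=.
by rewrite modn_small // ltnS ltn_ord.
Qed.

Lemma W_covers_X (d : event X) :
  exists2 m : mor W X, m \in Tbar W X & exists e, (val m).2 e = d.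
Proof.
have [dlt|dge] := boolP (d < 2).
  exists iotaWX; first exact: iotaWX_Tbar.
  by exists (Ordinal dlt); rewrite ffunE; apply/val_inj.
(* [iotaWX] misses event 2; rotating it around the cycle by one actor reaches events 1 and 2. *)
have [||| m mE mT] := @Tbar_mor W X
    ([ffun i : 'I_3 => ordS i], [ffun e : 'I_2 => lift ord0 e]).
- by move=> a b; rewrite /= !ffunE; apply: bij_inj; apply: ordS_bij.
- by move=> a b; rewrite /= !ffunE; apply: lift_inj.
- by case=> -[|[|[|?]]] // p [[|[|?]] // q]; rewrite /= !ffunE.
exists m => //; exists (@Ordinal 2 1 isT); rewrite mE /= ffunE.
by apply/val_inj; case: d dge => -[|[|[|?]]].
Qed.

Lemma X_exact (K : triad) (f : mor X K) :
  (forall m : mor W X, m \in Tbar W X -> exact_map (val (mor_comp f m))) ->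
  exact_map (val f).
Proof.
move=> fm a d; have [m mT [e <-]] := W_covers_X d.
have [g _ gK] := mor_actor_bij m; rewrite -[a]gK.
have [_ ->] := TbarP _ mT; rewrite -(fm m mT) /= !ffunE //.
Qed.

Lemma admissible_W (C : mor_family) (R : rel_family) (K : triad) :
  admissible C R -> C W K = Tbar W K.
Proof.
move=> [subC CR ax1 ax2 /(axiom3P CR) det].
apply/eqP; rewrite eqEsubset ax1 andbT; apply/subsetP => f fC.
exact: (exact_Tbar W_separated (determined_exact subC ax1 ax2 det fC)).
Qed.

(** Axiom 3 does not constrain alcoves, so exactness on [X] is deduced from that of the composites
    with embeddings of [W], which belong to [C] and hence to [Tbar]. *)
Lemma admissible_X (C : mor_family) (R : rel_family) (K : triad) :
  admissible C R -> C X K = Tbar X K.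
Proof.
move=> adm; have [[_ Ccomp] _ ax1 _ _] := adm.
apply/eqP; rewrite eqEsubset ax1 andbT; apply/subsetP => f fC.
apply: exact_Tbar; first exact: X_separated.
apply: X_exact => m mT; apply: (TbarP _ _).2.
rewrite -(admissible_W _ adm); apply: Ccomp => //.
by rewrite (admissible_W _ adm).
Qed.

(** Axiom 2 bounds [R] from above by [simeq]; being determined by actors bounds it from below. *)
Lemma determined_simeq (C : mor_family) (R : rel_family) (H K : triad) :
  axiom2 C R -> actor_determined C R H K -> C H K = Tbar H K ->
  {in Tbar H K &, R H K =2 @simeq H K}.
Proof.
move=> ax2 det eqC f f' fT f'T; apply/idP/idP; first by apply: ax2; rewrite eqC.
by move/simeqP=> [eq1 _]; apply: det; rewrite ?eqC.
Qed.

Lemma admissible_same_choice (C : mor_family) (R : rel_family) :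
  admissible C R -> same_choice C R Tbar simeq.
Proof.
move=> adm G; have [_ CR _ ax2 /(axiom3P CR) detW] := adm.
have HomW : HomC C R W G = HomC Tbar simeq W G.
  apply/setP => u; rewrite !inE (@eq_classes Tbar _ simeq) //.
    exact: (admissible_W _ adm).
  exact: determined_simeq ax2 (detW _ _) (admissible_W _ adm).
split=> //.
- apply/setP => u; rewrite /HomCX HomW !inE; congr (_ && _).
  apply/exists_inP/exists_inP => -[psi psiC psiw]; exists psi => //;
    by move: psiC; rewrite (admissible_X _ adm).
- move=> /(one_alcoveP CR) detX; apply/setP => u; rewrite !inE.
  rewrite (@eq_classes Tbar _ simeq) //; first exact: (admissible_X _ adm).
  exact: determined_simeq ax2 (detX _ _) (admissible_X _ adm).
move=> S T; split; first exact: (admissible_X _ adm).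
by move=> f f' fT f'T; apply: ax2; rewrite (admissible_X _ adm).
Qed.

(** * Closure of wedges with different centers *)

Lemma W_event_missing (c : actor W) :
  c != v2 -> exists e : event W, forall a, attends a e = (a != c).
Proof.
(* Each event of the path omits one end: event 1 omits [v0], event 0 omits [v4]. *)
case: (ord3P c) => ->; rewrite ?eqxx // => _;
  [exists (@Ordinal 2 1 isT)|exists (@Ordinal 2 0 isT)] => a;
  by rewrite /= -val_eqE /= !inordK //; case: a => -[|[|[|?]]].
Qed.

(** [X] is [W] with a third event joining its two ends, and [d] serves as the image of that
    event. *)
Lemma wedge_extend (K : triad) (f : mor W K) (d : event K) :
  f \in Tbar W K -> (forall x, attends x d = (x != (val f).1 v2)) ->
  exists2 psi : mor X K, psi \in Tbar X K & (val psi).1 = (val f).1.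
Proof.
move=> /TbarP[_ fE] dE.
(* [insub] recovers events 0 and 1 of [W] among those of [X] and fails on event 2, which goes to
   [d]. *)
pose p : bimap X K := ((val f).1, [ffun e : 'I_3 =>
  if insub (val e) is Some e' then (val f).2 e' else d]).
have pE : exact_map p.
  move=> a e; rewrite /= ffunE; case: insubP => [e' lt2 ee'|ge2].
    by rewrite fE /= ee' [e.+1 %% 3]modn_small.
  rewrite dE (inj_eq (@mor_actor_inj _ _ f)) -val_eqE /= inordK //.
  by case: e a ge2 => -[|[|[|?]]] // ? [[|[|[|?]]]].
have pP : is_mor p.
  by apply/is_morP; split=> [|a e ae]; [exact: (@mor_actor_inj _ _ f) | rewrite pE].
by exists (exist _ p pP) => //; apply: exact_Tbar => //; apply: X_separated.
Qed.

(** The center of [f] is the image under [g] of an end of [W]. The event of [W] omitting that end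
    has as its image under [g] an event joining the two ends of [f], which closes [f]. *)
Lemma wedge_closed (K : triad) (w : {set mor W K}) (f g : mor W K) :
  w \in classes_in Tbar simeq W K -> f \in w -> g \in Tbar W K ->
  (val f).1 v2 != (val g).1 v2 -> closed_in Tbar w.
Proof.
move=> wC fw gT fg; have [fT ->] := mem_classes simeq_congruence wC fw.
have [g' _ gK] := mor_actor_bij g.
have [|e eE] := @W_event_missing (g' ((val f).1 v2)).
  by apply: contra fg => /eqP g'f; rewrite -[in eqbRHS]g'f gK.
have [|psi psiT psi1] := @wedge_extend _ f ((val g).2 e) fT.
  have [_ gE] := TbarP _ gT => x.
  by rewrite -[x]gK gE eE -(inj_eq (@mor_actor_inj _ _ g)) !gK.
have psiI := Tbar_comp iotaWX_Tbar psiT.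
apply/exists_inP; exists psi => //; rewrite inE psiI simeq_Tbar //=.
by apply/eqP/ffunP => a; rewrite !ffunE psi1.
Qed.

Lemma Tbar_axiom4 : axiom4 Tbar simeq.
Proof.
move=> G S i j k i' j' k' jj' w w' wC w'C.
case/exists_inP=> f fw /and3P[_ /eqP f2 _].
case/exists_inP=> g gw /and3P[_ /eqP g2 _].
have [fT _] := mem_classes simeq_congruence wC fw.
have [gT _] := mem_classes simeq_congruence w'C gw.
split; [apply: (wedge_closed wC fw gT) | apply: (wedge_closed w'C gw fT)];
  by rewrite f2 g2 // eq_sym.
Qed.

(** * The bijection between alcoves and closed wedges *)

Lemma simeq_comp_iota (K : triad) : {in Tbar X K &, forall psi psi',
  simeq (mor_comp psi iotaWX) (mor_comp psi' iotaWX) = simeq psi psi'}.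
Proof.
move=> psi psi' psiT psi'T; rewrite !simeq_Tbar ?Tbar_comp ?iotaWX_Tbar //.
(* On [Tbar] only actor maps are compared, and [iotaWX] is the identity on actors. *)
apply/eqP/eqP => /ffunP eq1; apply/ffunP => a; have := eq1 a; rewrite !ffunE //.
Qed.

(** Precomposition with [iotaWX], lifted to classes; the existential avoids choosing a
    representative. *)
Definition wedges_of (K : triad) (a : {set mor X K}) : {set mor W K} :=
  [set f in Tbar W K | [exists psi in a, simeq (mor_comp psi iotaWX) f]].

Lemma wedges_of_class (K : triad) (psi : mor X K) : psi \in Tbar X K ->
  wedges_of [set g in Tbar X K | simeq psi g] =
  [set f in Tbar W K | simeq (mor_comp psi iotaWX) f].
Proof.
move=> psiT; apply/setP => f; rewrite [LHS]in_set [RHS]in_set.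
have [fT|] //= := boolP (f \in Tbar W K).
have psiI := Tbar_comp iotaWX_Tbar psiT.
apply/exists_inP/idP => [[psi']|psif].
  case/setIdP=> psi'T; rewrite -simeq_comp_iota //.
  have psi'I := Tbar_comp iotaWX_Tbar psi'T.
  by rewrite !simeq_Tbar // => /eqP->.
by exists psi => //; apply: class_refl (simeq_congruence) _.
Qed.

Lemma card_closed_wedges (G : affnet) :
  #|HomCX Tbar simeq G| = #|HomC Tbar simeq X G|.
Proof.
pose F (u : {S : actor_triple G & {set mor X (triad_of S)}}) :
    {S : actor_triple G & {set mor W (triad_of S)}} :=
  Tagged (fun S => {set mor W (triad_of S)}) (wedges_of (tagged u)).
rewrite -(card_in_imset (f := F)); last first.
  move=> [S a] [S' a']; rewrite !inE /= => aC a'C eqF.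
  have /= eqS := congr1 tag eqF.
  (* Identifying the tags puts both alcoves over the same triad, where their classes can be
     compared. *)
  case: S' / eqS a' a'C eqF => a' a'C /eqP; rewrite eq_Tagged /= => /eqP.
  case/imsetP: aC => psi psiT ->; case/imsetP: a'C => psi' psi'T ->.
  (* Injectivity: testing the equal wedges on [mor_comp psi' iotaWX] yields [simeq psi psi']. *)
  rewrite !wedges_of_class // => /setP/(_ (mor_comp psi' iotaWX)).
  rewrite [LHS]in_set [RHS]in_set Tbar_comp ?iotaWX_Tbar //= !simeq_comp_iota //.
  have [eqR _] := simeq_congruence.
  have [-> _] := eqR _ _ _ _ _ psi'T psi'T psi'T => Rpsi; congr Tagged.
  apply/setP => g; rewrite [LHS]in_set [RHS]in_set.
  case gT: (g \in Tbar X _) => //=.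
  by have [_ ->] := eqR _ _ _ _ _ psiT psi'T gT.
congr #|pred_of_set _|; apply/setP => u; apply/idP/imsetP => [|[[S a] aC ->]].
  (* Surjectivity: a closed wedge comes from the alcove of the morphism [psi] that closes it. *)
  case: u => S w /setIdP[]; rewrite inE /= => wC /exists_inP[psi psiT psiw].
  exists (Tagged (fun S => {set mor X (triad_of S)})
            [set g in Tbar X (triad_of S) | simeq psi g]).
    by rewrite inE; apply: class_in.
  have [_ ->] := mem_classes simeq_congruence wC psiw.
  by rewrite /F /= wedges_of_class.
move: aC; rewrite inE /= => /imsetP[psi psiT ->].
have psiI := Tbar_comp iotaWX_Tbar psiT.
apply/setIdP; rewrite inE /F /= wedges_of_class //; split; first exact: class_in.
by apply/exists_inP; exists psi => //; apply: class_refl simeq_congruence _.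
Qed.

Theorem theorem3 :
  exists (C : mor_family) (R : rel_family),
    [/\ admissible C R /\ one_alcove C R,
        forall (C' : mor_family) (R' : rel_family),
          admissible C' R' -> same_choice C' R' C R,
        axiom4 C R,
        forall G : affnet, closure_rate C R G = exclusive_cc G
      & forall G : affnet, alcove_wedge_ratio C R G = exclusive_cc G].
Proof.
exists Tbar, simeq; split=> //.
- split; first exact: Tbar_admissible.
  apply/one_alcoveP; first exact: simeq_congruence.
  by move=> G S; apply: simeq_determined.
- exact: admissible_same_choice.
- exact: Tbar_axiom4.
(* The closure rate for this choice is [exclusive_cc] by definition, so only the alcove count needs
   the bijection. *)
by move=> G; rewrite /alcove_wedge_ratio -card_closed_wedges.
Qed.
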